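(* For all integers $p,q\geq 3$, $\mathrm{mbt}(K_p\Box C_q)=\Delta(K_p\Box C_q)+1$, where $K_p$ is the complete graph on $p$ vertices and $C_q$ is the cycle on $q$ vertices.
   Context: A book embedding of a graph $G$ consists of a linear ordering of $V(G)$ (the vertices placed on the spine) together with an assignment of each edge to one of a set of pages such that no two edges on the same page cross, i.e. there are no two edges $uv$, $xy$ on the same page with $u<x<v<y$ in the ordering. A book embedding is matching if on every page each vertex is incident with at most one edge of that page (the edges of each page form a matching). The matching book thickness $\mathrm{mbt}(G)$ is the minimum number of pages over all matching book embeddings of $G$. $\Delta(G)$ denotes the maximum degree of $G$. The Cartesian product $G\Box B$ has vertex set $V(G)\times V(B)$, with $(u_1,v_1)$ adjacent to $(u_2,v_2)$ iff either $u_1=u_2$ and $v_1v_2\in E(B)$, or $v_1=v_2$ and $u_1u_2\in E(G)$. *)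

(* Defs.v *)
(* Simple graphs are symmetric irreflexive relations on finTypes. *)
From mathcomp Require Import all_boot.
Set Implicit Arguments. Unset Strict Implicit. Unset Printing Implicit Defensive.

Definition Kg (p : nat) : rel 'I_p := fun i j => i != j.

Definition Cg (q : nat) : rel 'I_q :=
  fun i j => (val j == (val i).+1 %% q) || (val i == (val j).+1 %% q).

Definition cartprod (T1 T2 : finType) (e1 : rel T1) (e2 : rel T2) : rel (T1 * T2) :=
  fun x y => ((x.1 == y.1) && e2 x.2 y.2) || ((x.2 == y.2) && e1 x.1 y.1).

Definition maxdeg (T : finType) (e : rel T) : nat :=
  \max_(v : T) #|[set w | e v w]|.

(* A matching book embedding of the graph (T, e) with k pages:
   pos : injective map giving the linear order of the vertices on the spine;
   pg u v : the page of the edge uv (symmetric in u v). *)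
Definition matching_book_embedding (T : finType) (e : rel T) (k : nat)
    (pos : T -> nat) (pg : T -> T -> 'I_k) : Prop :=
  [/\ injective pos,
      (forall u v, e u v -> pg u v = pg v u),
      (forall u v x y, e u v -> e x y -> pg u v = pg x y ->
          ~ [/\ pos u < pos x, pos x < pos v & pos v < pos y]) &
      (forall u v w, e u v -> e u w -> v != w -> pg u v != pg u w)].

Definition has_mbe (T : finType) (e : rel T) (k : nat) : Prop :=
  exists pos pg, @matching_book_embedding T e k pos pg.

Definition is_mbt (T : finType) (e : rel T) (m : nat) : Prop :=
  has_mbe e m /\ forall k, has_mbe e k -> m <= k.

(* Main.v *)
Require Import Defs.
From mathcomp Require Import all_boot zify.

(** Lower bound: the graph is (p+1)-regular, and a regular graph of degree d embedded in d
    pages is bipartite, whereas a layer K_p contains a triangle.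

    Upper bound: the q copies of K_p are consecutive blocks of the spine, alternately
    descending and ascending, so that all links between two consecutive blocks can share one
    page; page p-1 serves in this way the links from odd layers t to t+1 (and from layer q-1
    to layer 0 for q even).  A copy of K_p whose vertices are 0, ..., p-1 is coloured by i+j
    mod p+1, so the point p of the regular (p+1)-gon is free: the colour of the chord from i
    to p is missing at i, and an edge leaving the block from i in that colour crosses no
    chord of the class.  Each remaining link leaves its block in this way, the p links of one
    bundle being on p distinct pages.  For q odd, layer 0 has two such bundles: it is coloured
    modulo p+2, with the two free points p and p+1. *)

(** * Page assignment and spine order *)

(** Residue modulo [n] of any [s < 2 * n], in a form that [lia] handles for variable [n]. *)
Definition wrap (n s : nat) : nat := if s < n then s else s - n.

(* [s] is the sum [i + j] of the end points of an edge of layer [t].  The residues mod [p.+1]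
   are renamed so as to avoid page [p.-1] and to send [i + p] to the page of the link leaving
   the layer from [i]; layer [q.-1] for odd [q] needs a renaming of its own. *)
Definition layer_page (p q t s : nat) : nat :=
  if odd q && (t == 0) then wrap p.+2 s
  else let r := wrap p.+1 s in
    if odd q && (t == q.-1) then
      if r == 0 then p.+1 else if r == p then p else r.-1
    else if r < p.-1 then r else r.+1.

(* The link from layer [t] to the cyclically next layer, at the vertex [i] of K_p. *)
Definition link_page (p q t i : nat) : nat :=
  if t == q.-1 then (if odd q then wrap p.+2 (i + p) else p.-1)
  else if odd t then p.-1 else wrap p.+2 (i + p.+1).

Definition spine_pos (p t i : nat) : nat :=
  t * p + (if odd t then i else p.-1 - i).

(* Only innermost conditionals are split, so that [lia] sees conditions without [if]. *)
Ltac pages := rewrite /layer_page /link_page /wrap /=;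
  repeat match goal with |- context [if ?b then _ else _] =>
    lazymatch b with context [if _ then _ else _] => fail | _ => case: (boolP b) => ? end end;
  try lia.

(** * Page conflicts between chords and links *)

(** The sums differ by a positive amount below [p], hence also modulo [p.+1] and [p.+2], and the
    renaming of residues is injective. *)
Lemma layer_page_noncrossing p q t i j k l :
  2 < p -> i < k -> k < j -> j < l -> l < p ->
  layer_page p q t (i + j) <> layer_page p q t (k + l).
Proof. move=> *; pages. Qed.

Lemma layer_page_inj p q t i j l :
  2 < p -> i < p -> j < p -> l < p ->
  layer_page p q t (i + j) = layer_page p q t (i + l) -> j = l.
Proof. move=> ????; pages. Qed.

(** Here [k <= i + j < k + p], while a link at [k] has residue [k - 1] or [k - 2], or else page
    [p.-1], which the layer then avoids. The range of [k] covers both a shared end point and a link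
    starting under the chord. *)
Lemma layer_page_link p q t t' i j k :
  2 < p -> 2 < q -> t < q -> i <= k -> k <= j -> i < j -> j < p ->
  t' = t \/ t = t'.+1 \/ t = 0 /\ t' = q.-1 ->
  layer_page p q t (i + j) <> link_page p q t' k.
Proof. move=> ????????; pages. Qed.

(** One of the two bundles has odd index, hence page [p.-1], which bundles of even index avoid. *)
Lemma link_page_consecutive p q t i j :
  2 < p -> t.+1 < q -> i < p -> j < p -> link_page p q t i <> link_page p q t.+1 j.
Proof. move=> ????; pages. Qed.

(** A common page occurs only for odd [q], with [j = i.+1]; as layer 0 descends, the closing link
    then encloses the other one. *)
Lemma link_page_closing p q i j :
  2 < p -> 2 < q -> i < p -> j < p -> link_page p q 0 i = link_page p q q.-1 j -> i < j.
Proof. move=> ????; pages. Qed.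

Lemma link_page_inj p q t i j :
  2 < p -> t < q -> i < p -> j < p -> link_page p q t i = link_page p q t j ->
  i = j \/ odd t.
Proof. move=> ????; pages. Qed.

Lemma layer_page_lt p q t i j :
  2 < p -> i < p -> j < p -> i != j -> layer_page p q t (i + j) < p.+2.
Proof. move=> ????; pages. Qed.

Lemma link_page_lt p q t i :
  2 < p -> i < p -> link_page p q t i < p.+2.
Proof. move=> ??; pages. Qed.

(** * Order along the spine *)

Lemma spine_pos_lt p t t' i j :
  i < p -> j < p -> spine_pos p t i < spine_pos p t' j ->
  t < t' \/ t = t' /\ (if odd t then i < j else j < i).
Proof.
move=> hi hj; rewrite /spine_pos; case: (ltngtP t t') => [||->]; first by left.
- move=> h; have : t'.+1 * p <= t * p by rewrite leq_mul2r h orbT.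
  rewrite mulSn; do 2!case: ifP => _; lia.
- by case: ifP => _ ?; right; split=> //; lia.
Qed.

Lemma spine_pos_inj p t t' i j :
  i < p -> j < p -> spine_pos p t i = spine_pos p t' j -> t = t' /\ i = j.
Proof.
move=> hi hj; rewrite /spine_pos; case: (ltngtP t t') => [h|h|->].
- have : t.+1 * p <= t' * p by rewrite leq_mul2r h orbT.
  rewrite mulSn; do 2!case: ifP => _; lia.
- have : t'.+1 * p <= t * p by rewrite leq_mul2r h orbT.
  rewrite mulSn; do 2!case: ifP => _; lia.
- case: ifP => _ ?; split=> //; lia.
Qed.

(** * Edges of the product and validity of the embedding *)

(** A bundle is numbered by the layer whose cyclic successor it reaches; this form is symmetric in
    the two layers. *)
Definition link_index (q t t' : nat) : nat :=
  if maxn t t' == (minn t t').+1 then minn t t' else q.-1.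

Definition edge_page (p q : nat) (u v : 'I_p * 'I_q) : nat :=
  if u.2 == v.2 then layer_page p q u.2 (u.1 + v.1)
  else link_page p q (link_index q u.2 v.2) u.1.

Lemma Cg_link (q : nat) (t t' : 'I_q) : 2 < q -> Cg t t' ->
  [\/ t' = t.+1 :> nat /\ link_index q t t' = t,
      t = t'.+1 :> nat /\ link_index q t t' = t',
      [/\ t = 0 :> nat, t' = q.-1 :> nat & link_index q t t' = q.-1] |
      [/\ t' = 0 :> nat, t = q.-1 :> nat & link_index q t t' = q.-1]].
Proof.
move=> hq; have ltt := ltn_ord t; have ltt' := ltn_ord t'.
rewrite /link_index; case/orP => /eqP /=.
- have [lt1|ge1] := ltnP t.+1 q.
    by rewrite modn_small // => h; constructor 1; split=> //; case: ifP; lia.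
  have -> : t.+1 = q by lia.
  by rewrite modnn => h; constructor 4; split; [lia|lia|case: ifP; lia].
- have [lt1|ge1] := ltnP t'.+1 q.
    by rewrite modn_small // => h; constructor 2; split=> //; case: ifP; lia.
  have -> : t'.+1 = q by lia.
  by rewrite modnn => h; constructor 3; split; [lia|lia|case: ifP; lia].
Qed.

Lemma edge_page_cases (p q : nat) (u v : 'I_p * 'I_q) :
  2 < q -> cartprod (@Kg p) (@Cg q) u v ->
  [/\ u.2 = v.2 :> nat, u.1 <> v.1 :> nat &
      edge_page p q u v = layer_page p q u.2 (u.1 + v.1)] \/
  exists s, [/\ u.1 = v.1 :> nat, edge_page p q u v = link_page p q s u.1 &
    [\/ v.2 = u.2.+1 :> nat /\ s = u.2,
        u.2 = v.2.+1 :> nat /\ s = v.2,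
        [/\ u.2 = 0 :> nat, v.2 = q.-1 :> nat & s = q.-1] |
        [/\ v.2 = 0 :> nat, u.2 = q.-1 :> nat & s = q.-1]]].
Proof.
case: u v => [i t] [j t'] hq; rewrite /edge_page /=; case/orP => /= /andP[/eqP e12 h].
- right; exists (link_index q t t'); have c := Cg_link q t t' hq h.
  split=> //; first by rewrite e12.
  case: eqP => // e2; exfalso; move: c (ltn_ord t'); rewrite e2.
  by case=> [[]|[]|[]|[]]; lia.
- left; rewrite e12 eqxx; split=> //.
  by move/val_inj => e; rewrite /Kg e eqxx in h.
Qed.

Lemma edge_page_lt (p q : nat) (u v : 'I_p * 'I_q) :
  2 < p -> 2 < q -> cartprod (@Kg p) (@Cg q) u v -> edge_page p q u v < p.+2.
Proof.
move=> hp hq /(edge_page_cases _ _ _ _ hq) [[_ /eqP ne ->]|[s [_ -> _]]].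
- exact: layer_page_lt.
- exact: link_page_lt.
Qed.

Lemma edge_page_sym (p q : nat) (u v : 'I_p * 'I_q) :
  cartprod (@Kg p) (@Cg q) u v -> edge_page p q u v = edge_page p q v u.
Proof.
rewrite /edge_page /link_index maxnC minnC; case/orP => /andP[/eqP ->] _.
  by case: (eqVneq u.2 v.2) => [->|//]; rewrite ?eqxx.
by rewrite !eqxx addnC.
Qed.

Lemma edge_page_matching (p q : nat) (u v w : 'I_p * 'I_q) :
  2 < p -> 2 < q -> cartprod (@Kg p) (@Cg q) u v ->
  cartprod (@Kg p) (@Cg q) u w -> edge_page p q u v = edge_page p q u w -> v = w.
Proof.
case: u v w => [i t] [j t'] [k t''] hp hq euv euw.
have val_pair (a b : 'I_p) (c d : 'I_q) : a = b :> nat -> c = d :> nat -> (a, c) = (b, d).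
  by move=> /val_inj -> /val_inj ->.
have layer_link (x : 'I_p) (y : 'I_q) (s : nat) : i <> x :> nat ->
    [\/ y = t.+1 :> nat /\ s = t,
        t = y.+1 :> nat /\ s = y,
        [/\ t = 0 :> nat, y = q.-1 :> nat & s = q.-1] |
        [/\ y = 0 :> nat, t = q.-1 :> nat & s = q.-1]] ->
    layer_page p q t (i + x) <> link_page p q s i.
  move=> ne hs; have [lt|ge] := ltnP i x.
    by apply: layer_page_link => //; case: hs => [[]|[]|[]|[]]; lia.
  by rewrite addnC; apply: layer_page_link => //; case: hs => [[]|[]|[]|[]]; lia.
case: (edge_page_cases _ _ _ _ hq euv) => /= [[e2 ne ->]|[s [e1 -> hs]]];
  case: (edge_page_cases _ _ _ _ hq euw) => /= [[e2' ne' ->]|[s' [e1' -> hs']]].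
- move/layer_page_inj => h; apply: val_pair; last by rewrite -e2.
  by apply: h.
- by move=> h; case: (layer_link j t'' s' ne hs').
- by move=> h; case: (layer_link k t' s ne' hs).
(* Two links at one vertex belong to the same bundle, to consecutive bundles, or to bundles 0 and
   [q.-1]; only in the first case can the pages agree. *)
- move=> h; apply: val_pair; first by rewrite -e1.
  have cons := link_page_consecutive p q _ i i hp _ (ltn_ord _) (ltn_ord _).
  have clos := link_page_closing p q i i hp hq (ltn_ord _) (ltn_ord _).
  have key a b : a.+1 = b -> b < q -> link_page p q a i <> link_page p q b i.
    by move=> <- hb; apply: cons.
  have k1 : ~ link_page p q 0 i = link_page p q q.-1 i by move/clos; rewrite ltnn.
  have := ltn_ord t; have := ltn_ord t'; have := ltn_ord t''; move=> lt'' lt' ltt.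
  case: hs hs' => [[a b]|[a b]|[a b c]|[a b c]] [[a' b']|[a' b']|[a' b' c']|[a' b' c']];
    try lia; exfalso; move: h; rewrite ?b ?b' ?c ?c'.
  all: try by apply: key; lia.
  all: try by move/esym; apply: key; lia.
  all: try by rewrite ?a ?a'; move/k1.
  all: try by rewrite ?a ?a'; move/esym/k1.
Qed.

(** Orientation along the spine leaves three types of edge, so that crossings reduce to nine
    pairs. *)
Lemma edge_page_forward_cases (p q : nat) (u v : 'I_p * 'I_q) :
  2 < q -> cartprod (@Kg p) (@Cg q) u v ->
  spine_pos p u.2 u.1 < spine_pos p v.2 v.1 ->
  [\/ [/\ v.2 = u.2 :> nat, if odd u.2 then u.1 < v.1 else v.1 < u.1 &
          edge_page p q u v = layer_page p q u.2 (u.1 + v.1)],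
      [/\ v.2 = u.2.+1 :> nat, v.1 = u.1 :> nat &
          edge_page p q u v = link_page p q u.2 u.1] |
      [/\ u.2 = 0 :> nat, v.2 = q.-1 :> nat, v.1 = u.1 :> nat &
          edge_page p q u v = link_page p q q.-1 u.1]].
Proof.
move=> hq euv /(spine_pos_lt _ _ _ _ _ (ltn_ord _) (ltn_ord _)).
have := edge_page_cases _ _ _ _ hq euv; have := ltn_ord u.2.
case: u v euv => [i t] [j t'] _ /= ltt [[e2 ne ->]|[s [e1 -> hs]]].
- by case=> [|[_ h]]; [lia|constructor 1].
- move=> h; case: hs => [[a b]|[a b]|[a b c]|[a b c]].
  + by constructor 2; rewrite b.
  + by move: h; rewrite a; case=> [|[]]; lia.
  + by constructor 3; rewrite c.
  + by move: h; rewrite a b; case=> [|[]]; lia.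
Qed.

Lemma edge_page_noncrossing (p q : nat) (u v x y : 'I_p * 'I_q) :
  2 < p -> 2 < q -> cartprod (@Kg p) (@Cg q) u v -> cartprod (@Kg p) (@Cg q) x y ->
  edge_page p q u v = edge_page p q x y ->
  ~ [/\ spine_pos p u.2 u.1 < spine_pos p x.2 x.1,
        spine_pos p x.2 x.1 < spine_pos p v.2 v.1 &
        spine_pos p v.2 v.1 < spine_pos p y.2 y.1].
Proof.
move=> hp hq euv exy pe [ux xv vy].
have cuv := edge_page_forward_cases _ _ _ _ hq euv (ltn_trans ux xv).
have cxy := edge_page_forward_cases _ _ _ _ hq exy (ltn_trans xv vy).
move/(spine_pos_lt _ _ _ _ _ (ltn_ord _) (ltn_ord _)): ux => ux.
move/(spine_pos_lt _ _ _ _ _ (ltn_ord _) (ltn_ord _)): xv => xv.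
move/(spine_pos_lt _ _ _ _ _ (ltn_ord _) (ltn_ord _)): vy => vy.
move: cuv cxy pe ux xv vy.
case: u v x y euv exy => [[i hi] [t ht]] [[j hj] [t' ht']] [[k hk] [r hr]] [[l hl] [r' hr']] _ _ /=.
move: (edge_page _ _ _ _) (edge_page _ _ _ _) => P1 P2 cuv cxy pe ux xv vy; move: cuv cxy pe.
have closL : link_page p q 0 i = link_page p q q.-1 k -> i < k by apply: link_page_closing.
case=> [[ett oij ->]|[ett eij ->]|[t0 ett eij ->]] [[err okl ->]|[err ekl ->]|[r0 err ekl ->]];
  try subst j; try subst l; subst t' r'; try subst t; try subst r.
- have er : r = t by lia.
  subst r; case: (odd t) ux xv vy oij okl => ux xv vy oij okl.
    by apply: layer_page_noncrossing => //; lia.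
  (* An even layer descends, so the two chords exchange roles. *)
  rewrite (addnC i) (addnC k) => h; move: (Logic.eq_sym h).
  by apply: layer_page_noncrossing => //; lia.
- have er : r = t by lia.
  subst r; case: (odd t) ux xv vy oij => ux xv vy oij.
    by apply: layer_page_link => //; lia.
  by rewrite (addnC i); apply: layer_page_link => //; lia.
- have et : t = 0 by lia.
  by subst t; rewrite (addnC i); apply: layer_page_link => //=; move: ux xv oij => /=; lia.
- have er : r = t.+1 by lia.
  subst r; move: ux xv vy okl => /=.
  case: (odd t) => /= ux xv vy okl h; move: (Logic.eq_sym h).
    by rewrite (addnC k); apply: layer_page_link => //; lia.
  by apply: layer_page_link => //; lia.
(* Links of one bundle nest, since consecutive layers run in opposite directions. *)
- have [er|er] : r = t \/ r = t.+1 by lia.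
    by subst r; move: ux vy => /=; case: (odd t) => /=; lia.
  by subst r; apply: link_page_consecutive.
(* Layer 0 descends, so [k < i], whereas a common page forces [i < k]. *)
- have et : t = 0 by lia.
  by subst t; move/closL; move: ux => /=; lia.
- have er : r = q.-1 by lia.
  subst r; case: (odd q.-1) xv vy okl => xv vy okl h; move: (Logic.eq_sym h).
    by apply: layer_page_link => //; lia.
  by rewrite (addnC k); apply: layer_page_link => //; lia.
- have er : r.+1 = q.-1 by lia.
  by move=> h; move: (Logic.eq_sym h); rewrite -er; apply: link_page_consecutive.
(* Closing links have distinct pages for odd [q]; for even [q] layer [q.-1] ascends and they
   nest. *)
- move/link_page_inj => /(_ hp hr' hi hk).
  by move: ux vy => /=; case: (odd q.-1); lia.
Qed.

(** * Regular graphs embedded in as many pages as the degree *)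

(** [pos] selects one element of each orbit: [A] collects the left ones, and [m] maps [A] onto the
    rest of [S]. *)
Lemma even_card_involution (T : finType) (S : {set T}) (m : T -> T) (pos : T -> nat) :
  injective pos -> {in S, forall x, m x \in S} ->
  {in S, forall x, m (m x) = x} -> {in S, forall x, m x != x} -> ~~ odd #|S|.
Proof.
move=> ipos mS mK mN; pose A := [set x in S | pos x < pos (m x)].
have ltm x : x \in S -> (pos x < pos (m x)) || (pos (m x) < pos x).
  by move=> /mN; rewrite -neq_ltn;  apply: contraNneq => /ipos <-.
suff -> : #|S| = #|A| + #|A| by rewrite addnn odd_double.
rewrite -(cardsID A S); congr (_ + _).
  by apply: eq_card => x; rewrite !inE; case: (x \in S).
rewrite -(card_in_imset (f := m) (D := A)); last first.
  move=> x y; rewrite !inE => /andP[xS _] /andP[yS _] e.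
  by rewrite -(mK x xS) e mK.
apply: eq_card => x; apply/idP/imsetP.
  rewrite !inE => /andP[]; case xS: (x \in S) => //=.
  rewrite -leqNgt => h _; exists (m x); last by rewrite mK.
  rewrite inE mS // mK //=; have := ltm x xS; lia.
case=> y; rewrite !inE => /andP[yS lt] ->.
by rewrite mS //= mK // -leqNgt ltnW.
Qed.

Lemma mbe_degree (T : finType) (e : rel T) k (v : T) :
  has_mbe e k -> #|[set w | e v w]| <= k.
Proof.
case=> pos [pg [_ _ _ hm]]; rewrite -[k in _ <= k]card_ord.
apply: (leq_card_in (pg v)) => x y; rewrite !inE => ex ey /eqP pxy.
by apply/eqP; apply: contraTT pxy; apply: hm.
Qed.

(* With as many pages as the degree, every page is a noncrossing perfect matching, so an
   edge encloses an even number of spine vertices and the parity of the spine rank is a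
   proper 2-colouring. *)
Lemma regular_mbe_bipartite (T : finType) (e : rel T) d :
  symmetric e -> irreflexive e -> (forall v, #|[set w | e v w]| = d) -> has_mbe e d ->
  exists f : T -> bool, forall u v, e u v -> f u != f v.
Proof.
move=> esym eirr reg [pos [pg [ipos pgC cross match_]]].
have pg_inj x y z : e x y -> e x z -> pg x y = pg x z -> y = z.
  by move=> exy exz /eqP h; apply/eqP; apply: contraTT h; apply: match_.
(* The [d] edges at [w] lie on distinct pages, so they use all [d] pages. *)
have partner c w : exists v, e w v && (pg w v == c).
  have : c \in [set pg w v | v in [set v | e w v]].
    suff -> : [set pg w v | v in [set v | e w v]] = setT by rewrite inE.
    apply/eqP; rewrite eqEcard subsetT cardsT card_ord card_in_imset ?reg //=.
    by move=> x y; rewrite !inE; apply: pg_inj.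
  by case/imsetP => v; rewrite inE => ewv ->; exists v; rewrite ewv eqxx.
pose f v := odd #|[set w | pos w < pos v]|.
suff lt_case u v : e u v -> pos u < pos v -> f u != f v.
  exists f => u v euv; case: (ltngtP (pos u) (pos v)) => [|lt|/ipos uv].
  - exact: lt_case.
  - by rewrite eq_sym; apply: lt_case; rewrite // esym.
  - by rewrite uv eirr in euv.
move=> euv ltuv; pose c := pg u v.
pose m w := xchoose (partner c w).
have mP w : e w (m w) /\ pg w (m w) = c.
  by have /andP[? /eqP] := xchooseP (partner c w).
have mK w : m (m w) = w.
  have [e1 p1] := mP w; have [e2 p2] := mP (m w).
  by apply: (pg_inj (m w)) => //; rewrite ?(esym (m w)) // p2 -pgC.
have mu : m u = v by have [e1 p1] := mP u; apply: (pg_inj u).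
have mv : m v = u by rewrite -mu mK.
pose S := [set w | pos u < pos w < pos v].
have evenS : ~~ odd #|S|.
  apply: (@even_card_involution _ _ m pos) => // w; last first.
    by move=> _; apply/eqP => mw; have [] := mP w; rewrite mw eirr.
  rewrite !inE => /andP[uw wv]; have [ew pw] := mP w.
  have ew' : e (m w) w by rewrite esym.
  have pw' : pg (m w) w = c by rewrite -pgC.
  have nu : pos (m w) <> pos u.
    by move/ipos => h; move: wv; rewrite -(mK w) h mu ltnn.
  have nv : pos (m w) <> pos v.
    by move/ipos => h; move: uw; rewrite -(mK w) h mv ltnn.
  (* A partner of [w] to the right of [v] contradicts [c1], one to the left of [u] contradicts
     [c2]. *)
  have c1 := cross u v w (m w) euv ew (Logic.eq_sym pw).
  have c2 := cross (m w) w u v ew' euv pw'.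
  case: (ltngtP (pos u) (pos (m w))) => [a|a|h]; last by case: nu.
    by case: (ltngtP (pos (m w)) (pos v)) => [b|b|/nv //] //; case: c1.
  by case: c2.
(* The ranks of [u] and [v] differ by one, for [u] itself, plus the even number [#|S|]. *)
have -> : f v = odd (#|[set w | pos w < pos u]|.+1 + #|S|).
  rewrite /f; congr odd.
  have -> : [set w | pos w < pos v] = (u |: [set w | pos w < pos u]) :|: S.
    apply/setP => w; rewrite !inE -(inj_eq ipos).
    by case: (ltngtP (pos w) (pos u)) => //=; lia.
  rewrite cardsU cardsU1 inE ltnn /= add1n.
  suff -> : (u |: [set w | pos w < pos u]) :&: S = set0 by rewrite cards0 subn0.
  apply/setP => w; rewrite !inE -(inj_eq ipos).
  by case: (ltngtP (pos w) (pos u)).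
by rewrite oddD oddS (negbTE evenS) addbF /f; case: odd.
Qed.

(** * Symmetry and degrees of products, complete graphs and cycles *)

Lemma cartprod_sym (T1 T2 : finType) (e1 : rel T1) (e2 : rel T2) :
  symmetric e1 -> symmetric e2 -> symmetric (cartprod e1 e2).
Proof.
by move=> s1 s2 x y; rewrite /cartprod s1 s2 (eq_sym x.1) (eq_sym x.2).
Qed.

Lemma cartprod_irr (T1 T2 : finType) (e1 : rel T1) (e2 : rel T2) :
  irreflexive e1 -> irreflexive e2 -> irreflexive (cartprod e1 e2).
Proof. by move=> i1 i2 x; rewrite /cartprod i1 i2 !andbF. Qed.

Lemma cartprod_degree (T1 T2 : finType) (e1 : rel T1) (e2 : rel T2) (v : T1 * T2) :
  irreflexive e1 ->
  #|[set w | cartprod e1 e2 v w]| = #|[set x | e1 v.1 x]| + #|[set y | e2 v.2 y]|.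
Proof.
move=> i1; case: v => a b /=.
have -> : [set w | cartprod e1 e2 (a, b) w] =
    setX [set x | e1 a x] [set b] :|: setX [set a] [set y | e2 b y].
  apply/setP => [[x y]]; rewrite !inE /cartprod /= orbC (eq_sym x) (eq_sym y).
  by rewrite (andbC (b == y)).
rewrite cardsU !cardsX !cards1 muln1 mul1n.
suff -> : setX [set x | e1 a x] [set b] :&: setX [set a] [set y | e2 b y] = set0.
  by rewrite cards0 subn0.
apply/setP => [[x y]]; rewrite !inE /=.
by case: (eqVneq x a) => [->|]; rewrite ?i1 //= ?andbF.
Qed.

Lemma Kg_degree (p : nat) (i : 'I_p) : #|[set j | Kg i j]| = p.-1.
Proof.
rewrite -[p in RHS]card_ord -(cardsC1 i).
by apply: eq_card => j; rewrite !inE eq_sym.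
Qed.

Lemma Cg_sym (q : nat) : symmetric (@Cg q).
Proof. by move=> i j; rewrite /Cg orbC. Qed.

Lemma Cg_irr (q : nat) : 1 < q -> irreflexive (@Cg q).
Proof.
move=> hq i; rewrite /Cg orbb /=; apply/eqP; have := ltn_ord i.
have [lt|ge] := ltnP i.+1 q; first by rewrite modn_small //; lia.
move=> lt; have e : i.+1 = q by lia.
rewrite e modnn; lia.
Qed.

Lemma Cg_degree (q : nat) (t : 'I_q) : 2 < q -> #|[set s | Cg t s]| = 2.
Proof.
move=> hq; have ltt := ltn_ord t.
have -> : [set s | Cg t s] = [set ordS t; ord_pred t].
  apply/setP => s; rewrite !inE /Cg; congr (_ || _).
  by rewrite -[RHS](inj_eq (can_inj (@ordSK q))) ord_predK eq_sym.
rewrite cards2; suff -> : ordS t != ord_pred t by [].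
rewrite -(inj_eq val_inj) /=.
have [lt|ge] := ltnP t.+1 q.
  rewrite (modn_small lt); case: (posnP t) => [->|t0].
    by rewrite add0n modn_small; lia.
  have -> : (t + q).-1 = t.-1 + q by lia.
  by rewrite modnDr modn_small; lia.
have -> : t.+1 = q by lia.
have -> : (t + q).-1 = t.-1 + q by lia.
by rewrite modnn modnDr modn_small; lia.
Qed.

Theorem mainTheorem1 (p q : nat) (hp : 3 <= p) (hq : 3 <= q) :
  is_mbt (cartprod (@Kg p) (@Cg q))
         (maxdeg (cartprod (@Kg p) (@Cg q))).+1.
Proof.
have q_gt1 : 1 < q by apply: ltnW.
have deg v : #|[set w | cartprod (@Kg p) (@Cg q) v w]| = p.+1.
  rewrite cartprod_degree ?Kg_degree ?Cg_degree //; first lia.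
  by move=> i; rewrite /Kg eqxx.
have p_gt0 : 0 < p by lia.
have q_gt0 : 0 < q by lia.
pose t0 := Ordinal q_gt0.
have -> : maxdeg (cartprod (@Kg p) (@Cg q)) = p.+1.
  apply/eqP; rewrite eqn_leq; apply/andP; split.
    by apply/bigmax_leqP => v _; rewrite deg.
  by rewrite -(deg (Ordinal p_gt0, t0)); apply: leq_bigmax.
split.
  exists (fun v : 'I_p * 'I_q => spine_pos p v.2 v.1), (fun u v : 'I_p * 'I_q => inord (edge_page p q u v)).
  have page_inj u v x y : cartprod (@Kg p) (@Cg q) u v -> cartprod (@Kg p) (@Cg q) x y ->
      inord (edge_page p q u v) = inord (edge_page p q x y) :> 'I_p.+2 ->
      edge_page p q u v = edge_page p q x y.
    move=> euv exy /(congr1 (@nat_of_ord _)).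
    by rewrite !inordK //; apply: edge_page_lt.
  split.
  - move=> [i t] [j t'] /= /(spine_pos_inj _ _ _ _ _ (ltn_ord _) (ltn_ord _)).
    by case=> /val_inj -> /val_inj ->.
  - by move=> u v euv; rewrite edge_page_sym.
  - move=> u v x y euv exy /(page_inj _ _ _ _ euv exy).
    exact: edge_page_noncrossing.
  - move=> u v w euv euw; apply: contraNneq => /(page_inj _ _ _ _ euv euw).
    by move=> e; apply/eqP; apply: edge_page_matching e.
(* The degree gives [p.+1 <= k]; equality would make the graph bipartite. *)
move=> k hk; rewrite ltn_neqAle; apply/andP; split; last first.
  by rewrite -(deg (Ordinal p_gt0, t0)); apply: mbe_degree.
apply/eqP => kp; subst k.
have Kg_sym : symmetric (@Kg p) by move=> i j; rewrite /Kg eq_sym.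
have Kg_irr : irreflexive (@Kg p) by move=> i; rewrite /Kg eqxx.
have [f hf] := regular_mbe_bipartite _ _ _ (cartprod_sym _ _ _ _ Kg_sym (@Cg_sym q))
  (cartprod_irr _ _ _ _ Kg_irr (Cg_irr q q_gt1)) deg hk.
have p_gt1 : 1 < p by apply: ltnW.
(* Vertices 0, 1, 2 of layer 0 form a triangle, which has no proper 2-colouring. *)
pose a i : 'I_p * 'I_q := (i, t0).
have fa i j : i != j -> f (a i) != f (a j).
  by move=> ij; apply: hf; apply/orP; right; apply/andP.
have := fa (Ordinal p_gt0) (Ordinal p_gt1) isT.
have := fa (Ordinal p_gt1) (Ordinal hp) isT.
have := fa (Ordinal p_gt0) (Ordinal hp) isT.
by case: (f _); case: (f _); case: (f _).
Qed.
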